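(* Let $\xi=(\xi_n)_{n\ge 1}$ be a finite or infinite random sequence, defined on a probability space $(\Omega,\mathcal F,P)$ and taking values in a standard Borel space $(S,\mathcal S)$, with empirical distributions $\eta=(\eta_n)_{n\ge1}$, $\eta_n=n^{-1}\sum_{i=1}^n\delta_{\xi_i}$. Then $\xi$ is exchangeable if and only if $\eta$ forms a reverse, measure-valued martingale.
   Context: A finite or infinite sequence $\xi=(\xi_n)_{n\ge1}$ is exchangeable if for every positive integer $n$ (not exceeding the length of the sequence, if it is finite) and every permutation $\pi$ of $\{1,\dots,n\}$, $(\xi_{\pi(1)},\dots,\xi_{\pi(n)})$ has the same distribution as $(\xi_1,\dots,\xi_n)$. For each $n$, $\eta_n$ is regarded as a random element of the space $\mathcal P(\mathcal S)$ of probability measures on $(S,\mathcal S)$, equipped with the $\sigma$-field generated by the maps $\kappa\mapsto\kappa(B)$, $B\in\mathcal S$. Let $\mathcal T_n$ be the $\sigma$-field generated by $\eta_n,\eta_{n+1},\dots$ (up to the last index if the sequence is finite), i.e. by the random variables $\eta_k(B)$, $k\ge n$, $B\in\mathcal S$. The sequence $\eta$ is a reverse, measure-valued martingale if for every bounded measurable $f:S\to\mathbb R$, almost surely $E(\eta_n f\mid\mathcal T_{n+1})=\eta_{n+1}f$ for all $n\ge1$ (for a sequence of finite length $m$: for all $1\le n<m$), where $\eta_nf:=\int_S f\,d\eta_n=n^{-1}\sum_{i=1}^n f(\xi_i)$. *)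

(* Defs.v *)
From HB Require Import structures.
From mathcomp Require Import all_boot all_order all_algebra.
From mathcomp Require Import fingroup perm.
From mathcomp Require Import all_classical all_reals all_analysis.
From mathcomp Require Import measurable_realfun.

Set Implicit Arguments.
Unset Strict Implicit.
Unset Printing Implicit Defensive.

Import Order.TTheory GRing.Theory Num.Theory.
Import numFieldNormedType.Exports.

Local Open Scope classical_set_scope.
Local Open Scope ring_scope.

Definition complete_separable (R : realType) (M : metricType R) : Prop :=
  (exists2 D : set M, countable D & dense D) /\
  (forall u : nat -> M, cauchy (u @ \oo) -> exists l : M, u @ \oo --> l).

(* S is isomorphic, as a measurable space, to a complete separable metric space
   with its Borel sigma-algebra. *)
Definition standard_borel (R : realType) (d : measure_display)
    (S : measurableType d) : Prop :=
  exists (M : metricType R) (phi : S -> M),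
    [/\ complete_separable M, bijective phi &
        @measurable d S = preimage_set_system [set: S] phi <<s @open M >>].

(* A sequence of length N (None = infinite) is represented by a function on
   nat, the mathematical xi_(i+1) being xi i. When N = Some m, the values xi i
   with m <= i are not part of the sequence, and no definition below that takes
   N as an argument depends on them. *)
Definition within (N : option nat) (n : nat) : bool :=
  if N is Some m then (n <= m)%N else true.

Section sequences_of_random_elements.
Context (R : realType) (dT dS : measure_display).
Context (T : measurableType dT) (S : measurableType dS) (P : probability T R).
Implicit Types (xi : nat -> {RV P >-> S}) (N : option nat).

Definition joint xi n (g : 'I_n -> nat) (w : T) : n.-tuple S :=
  [tuple xi (g i) w | i < n].

Lemma measurable_joint xi n (g : 'I_n -> nat) :
  measurable_fun [set: T] (joint xi g).
Proof.
apply/measurable_fun_tnthP => i.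
rewrite (_ : _ \o _ = xi (g i)); first exact: measurable_funPT.
by apply/funext => w /=; rewrite tnth_mktuple.
Qed.

HB.instance Definition _ xi n (g : 'I_n -> nat) :=
  isMeasurableFun.Build _ _ _ _ (joint xi g) (measurable_joint xi g).

Definition exchangeable N xi : Prop :=
  forall n : nat, (0 < n)%N -> within N n ->
  forall (pi : 'S_n) (A : set (n.-tuple S)), measurable A ->
    distribution P (joint xi (fun i => pi i)) A =
    distribution P (joint xi (fun i => i)) A.

Definition empirical_measure xi n (w : T) : set S -> \bar R :=
  mscale (n.+1%:R^-1)%:nng (msum (fun i => dirac (xi i w)) n.+1).

HB.instance Definition _ xi n w :=
  Measure.on (empirical_measure xi n w).

Lemma empirical_measure_setT xi n w :
  empirical_measure xi n w [set: S] = 1%E.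
Proof.
rewrite /empirical_measure /mscale /= /msum.
have -> : \sum_(k < n.+1) dirac (xi k w) [set: S] = n.+1%:R%:E :> \bar R.
  by under eq_bigr do rewrite diracT; rewrite sumEFin sumr_const card_ord.
by rewrite -EFinM mulVf// pnatr_eq0.
Qed.

HB.instance Definition _ xi n w :=
  Measure_isProbability.Build _ _ _ (empirical_measure xi n w)
    (empirical_measure_setT xi n w).

(* The random probability measure eta_(n+1); the index is shifted because
   eta_0 does not exist. *)
Definition empirical xi n (w : T) : pprobability S R :=
  empirical_measure xi n w.

Lemma measurable_empirical xi n : measurable_fun [set: T] (empirical xi n).
Proof.
apply: (measurability (@pset _ _ _ : set (set (pprobability S R)))) => //.
move=> _ [_ [r _] [U mU <-] <-]; apply: emeasurable_fun_infty_o => //=.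
apply: measurable_funeM; apply: emeasurable_sum => i; apply/measurable_EFinP.
rewrite (_ : (fun _ => _) = \1_(xi i @^-1` U)) //.
exact/measurable_indic/measurable_funPTI.
Qed.

HB.instance Definition _ xi n :=
  isMeasurableFun.Build _ _ _ _ (empirical xi n) (measurable_empirical xi n).

(* The sigma-algebra generated by eta_(n+1), eta_(n+2), ... *)
Definition tail N xi n : set (set T) :=
  <<s \bigcup_(k in [set k | (n <= k)%N /\ within N k.+1])
        preimage_set_system [set: T] (empirical xi k) measurable >>.

(* Z is a version of the conditional expectation E(X | G). *)
Definition cond_expectation (G : set (set T)) (X Z : T -> R) : Prop :=
  [/\ P.-integrable [set: T] (EFin \o X),
      P.-integrable [set: T] (EFin \o Z),
      (forall B : set R, measurable B -> G (Z @^-1` B)) &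
      (forall A : set T, G A ->
        \int[P]_(w in A) Z w = \int[P]_(w in A) X w)].

Definition reverse_martingale N xi : Prop :=
  forall f : S -> R, measurable_fun [set: S] f -> bounded_fun f ->
  forall n : nat, within N n.+2 ->
  exists2 Z : T -> R,
    cond_expectation (tail N xi n.+1)
      (fun w => \int[empirical xi n w]_x f x) Z &
    {ae P, forall w, Z w = \int[empirical xi n.+1 w]_x f x}.

End sequences_of_random_elements.

(* Main.v *)
From HB Require Import structures.
From mathcomp Require Import all_boot all_order all_algebra.
From mathcomp Require Import fingroup perm.
From mathcomp Require Import all_classical all_reals all_analysis.
From mathcomp Require Import measurable_realfun ring lra.
Require Import Defs.

(** Write T_k for the sigma-algebra generated by eta_k, eta_(k+1), ...; the
    code shifts the indices by one: [xi i], [empirical xi n] and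
    [tail N xi n] are xi_(i+1), eta_(n+1) and T_(n+1).

    Since (n+1) eta_(n+1) = n eta_n + delta_(xi_(n+1)), the equation
      E(eta_n f | T_(n+1)) = eta_(n+1) f
    is equivalent to
      E(f(xi_(n+1)) | T_(n+1)) = eta_(n+1) f
    ([average_step_new_observation]): given the empirical measures from time
    n+1 on, the last observation is a uniform draw from the first n+1 ones.

    If xi is exchangeable, exchanging two of the first n+1 observations changes
    neither the law of xi nor any of eta_(n+1), eta_(n+2), ..., so that for
    every A in T_(n+1) the integrals over A of f(xi_1), ..., f(xi_(n+1)) are
    equal ([integral_tail]), hence all equal to that of eta_(n+1) f. For the
    events that constrain finitely many of the eta_k this is a statement about
    the law of finitely many observations ([integral_cylinder]); these events
    form a pi-system that generates T_(n+1), and Dynkin's theorem does the rest.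

    Conversely, if eta is a reverse martingale, the observations can be drawn
    one at a time, backwards from eta_n: each xi_k is a uniform draw from eta_k,
    and what remains is eta_(k-1). Hence, given eta_n, all the orderings of its
    atoms are equally likely. To avoid regular conditional distributions, the
    observations are first replaced by colours c(xi_i) from a finite set. For a
    word a of length n and A in T_n the claim is then ([word_law])

      n! P(A, (c(xi_1), ..., c(xi_n)) = a)
        = (prod_b (number of b in a)!)
            P(A, (c(xi_1), ..., c(xi_n)) rearranges a),

    by induction on n: if a is u followed by b, the event c(xi_(n+1)) = b lies
    in T_n because xi_(n+1) is determined by eta_n and eta_(n+1)
    ([tail_new_observation]), so the induction hypothesis for u applies with
    the intersection of A and c(xi_(n+1)) = b in place of A; then the martingale
    property replaces that event by the factor (number of b in a)/(n+1).

    The right-hand side depends on a only up to rearrangement. Colouring a point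
    by the list of the B_i that contain it, one finds that the probability that
    xi_(pi i) is in B_i for all i is the same for every permutation pi; such
    rectangles determine the law of (xi_1, ..., xi_n). *)

Set Implicit Arguments.
Unset Strict Implicit.
Unset Printing Implicit Defensive.

Import Order.TTheory GRing.Theory Num.Theory.
Import numFieldNormedType.Exports.

Local Open Scope classical_set_scope.
Local Open Scope ring_scope.

(** * Empirical measures and their integrals *)

(** Events about a random measure are sets of bundled measures, so comparing
    them calls for equality of the bundles and not only of the set functions. *)
Lemma eq_probability d (T : measurableType d) (R : realType)
    (m1 m2 : probability T R) :
  m1 = m2 :> (set T -> \bar R) -> m1 = m2.
Proof.
case: m1 m2 => [m1 c1] [m2 c2] /= m12; rewrite -m12 in c2 *.
congr Probability.Pack.
case: c1 c2 => [p1 p2 p3 p4 p5 p6 p7] [q1 q2 q3 q4 q5 q6 q7].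
have e1 : p1 = q1.
  by case: p1 q1 {p2 q2} => [? ?] [? ?]; congr isContent.Axioms_;
    exact: Prop_irrelevance.
rewrite -{}e1 in q2 *.
congr Probability.Class.
- by case: p2 q2 => [?] [?]; congr Content_isMeasure.Axioms_;
    exact: Prop_irrelevance.
- by case: p3 q3 => [?] [?]; congr isSFinite.Axioms_; exact: Prop_irrelevance.
- by case: p4 q4 => [?] [?]; congr isSigmaFinite.Axioms_;
    exact: Prop_irrelevance.
- by case: p5 q5 => [?] [?]; congr isFinite.Axioms_; exact: Prop_irrelevance.
- by case: p6 q6 => [?] [?]; congr isSubProbability.Axioms_;
    exact: Prop_irrelevance.
- by case: p7 q7 => [?] [?]; congr isProbability.Axioms_;
    exact: Prop_irrelevance.
Qed.

Section empirical.
Context (R : realType) (dT dS : measure_display).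
Context (T : measurableType dT) (S : measurableType dS) (P : probability T R).
Implicit Types xi : nat -> {RV P >-> S}.

Lemma empiricalE xi n w (B : set S) :
  empirical xi n w B = (n.+1%:R^-1 * \sum_(i < n.+1) \1_B (xi i w))%:E.
Proof.
rewrite /empirical /= /empirical_measure /mscale /= /msum /= EFinM -sumEFin.
by [].
Qed.

Lemma Rintegral_empirical xi n w (f : S -> R) : measurable_fun [set: S] f ->
  \int[empirical xi n w]_x f x = n.+1%:R^-1 * \sum_(i < n.+1) f (xi i w).
Proof.
move=> mf.
have ge0E (g : S -> R) : measurable_fun [set: S] g -> (forall x, 0 <= g x) ->
  (\int[empirical xi n w]_x (g x)%:E)%E =
    (n.+1%:R^-1 * \sum_(i < n.+1) g (xi i w))%:E.
  move=> mg g0.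
  have mEg : measurable_fun [set: S] (EFin \o g) by exact/measurable_EFinP.
  rewrite /empirical/= /empirical_measure.
  have g0E (x : S) : [set: S] x -> (0 <= (EFin \o g) x)%E by rewrite lee_fin.
  rewrite (ge0_integral_mscale (msum (fun i => dirac (xi i w)) n.+1))//.
  rewrite (ge0_integral_measure_sum (fun i => dirac (xi i w)))//.
  rewrite EFinM -sumEFin; congr (_ * _)%E; apply: eq_bigr => i _.
  by rewrite integral_dirac//= diracT mul1e.
rewrite /Rintegral integralE.
rewrite -[X in (X^\+)%E]/(EFin \o f) -[X in (X^\-)%E]/(EFin \o f).
rewrite funerpos funerneg.
rewrite !ge0E//=; last 2 first.
- exact: measurable_funrneg.
- exact: measurable_funrpos.
rewrite -mulrBr -sumrB; congr (_ * _); apply: eq_bigr => i _.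
by rewrite -[f in RHS]funrposBneg.
Qed.
End empirical.

(** An empirical measure forgets the order of the observations. Two probability
    spaces are involved so that this also transports empirical measures from
    the sample space to a space of tuples. *)
Lemma eq_empirical (R : realType) (d1 d2 dS : measure_display)
    (T1 : measurableType d1) (T2 : measurableType d2) (S : measurableType dS)
    (P1 : probability T1 R) (P2 : probability T2 R)
    (xi : nat -> {RV P1 >-> S}) (xi' : nat -> {RV P2 >-> S}) n w w'
    (s : 'S_n.+1) :
  (forall i : 'I_n.+1, xi' i w' = xi (s i) w) ->
  empirical xi' n w' = empirical xi n w.
Proof.
move=> xi_s; apply: eq_probability; apply/funext => B.
rewrite !empiricalE [in RHS](reindex_inj (@perm_inj _ s)).
by congr (_ * _)%:E; apply: eq_bigr => i _; rewrite xi_s.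
Qed.

Lemma Rintegral_sum d (T : measurableType d) (R : realType)
    (mu : {measure set T -> \bar R}) (D : set T) (I : Type) (s : seq I)
    (f : I -> T -> R) : measurable D ->
    (forall i, mu.-integrable D (EFin \o f i)) ->
  \int[mu]_(x in D) (\sum_(i <- s) f i x) =
  \sum_(i <- s) \int[mu]_(x in D) f i x.
Proof.
move=> mD intf; elim: s => [|i s IHs].
  by rewrite big_nil; under eq_Rintegral do rewrite big_nil;
    rewrite Rintegral_cst// mul0r.
under eq_Rintegral do rewrite big_cons.
rewrite big_cons RintegralD ?IHs//.
have -> : EFin \o (fun x => \sum_(j <- s) f j x) =
    (fun x => \sum_(j <- s) (EFin \o f j) x)%E.
  by apply/funext => x /=; rewrite sumEFin.
by apply: integrable_sum => // k _; exact: intf.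
Qed.

Section integrals.
Context (R : realType) (dT dS : measure_display).
Context (T : measurableType dT) (S : measurableType dS) (P : probability T R).
Context (f : S -> R) (mf : measurable_fun [set: S] f) (bf : bounded_fun f).
Implicit Types xi : nat -> {RV P >-> S}.

Lemma integrable_bounded_RV (X : {RV P >-> S}) (A : set T) : measurable A ->
  P.-integrable A (EFin \o (f \o X)).
Proof.
move=> mA; apply: (@integrableS _ _ _ _ setT) => //.
apply: measurable_bounded_integrable => //.
- by rewrite (le_lt_trans (probability_le1 P _))// ltry.
- by apply: measurableT_comp.
- have [M [Mr HM]] := bf; exists M; split => // x Mx w _.
  exact: HM.
Qed.

Lemma Rintegral_average xi n (A : set T) : measurable A ->
  \int[P]_(w in A) (\int[empirical xi n w]_x f x) =
  n.+1%:R^-1 * \sum_(i < n.+1) \int[P]_(w in A) f (xi i w).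
Proof.
move=> mA.
have ifxi i : P.-integrable A (EFin \o (f \o xi i)).
  exact: integrable_bounded_RV.
under eq_Rintegral do rewrite Rintegral_empirical//.
rewrite RintegralZl//; last first.
  have -> : EFin \o (fun w => \sum_(i < n.+1) f (xi i w)) =
      (fun w => \sum_(i < n.+1) (EFin \o (f \o xi i)) w)%E.
    by apply/funext => w /=; rewrite sumEFin.
  by apply: integrable_sum => // i _; exact: ifxi.
rewrite (@Rintegral_sum _ _ _ P A _ _ (fun (i : 'I_n.+1) w => f (xi i w)))//.
by move=> i; exact: ifxi.
Qed.

Lemma integrable_average xi n :
  P.-integrable [set: T] (EFin \o (fun w => \int[empirical xi n w]_x f x)).
Proof.
have -> : EFin \o (fun w => \int[empirical xi n w]_x f x) =
    (fun w => (n.+1%:R^-1)%:E * \sum_(i < n.+1) (EFin \o (f \o xi i)) w)%E.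
  by apply/funext => w /=; rewrite Rintegral_empirical// EFinM sumEFin.
apply: integrableZl => //; apply: integrable_sum => // i _.
exact: integrable_bounded_RV.
Qed.

(** The one-step martingale equation on [A] says that the new observation has
    the mean of all the observations so far: with m = n+1, s the sum of the
    integrals of the first m observations and t that of the new one, s/m =
    (s+t)/(m+1) and t = (s+t)/(m+1) are equivalent. *)
Lemma average_step_new_observation xi n (A : set T) : measurable A ->
  \int[P]_(w in A) (\int[empirical xi n w]_x f x) =
  \int[P]_(w in A) (\int[empirical xi n.+1 w]_x f x) <->
  \int[P]_(w in A) f (xi n.+1 w) =
  \int[P]_(w in A) (\int[empirical xi n.+1 w]_x f x).
Proof.
move=> mA; rewrite !Rintegral_average// [\sum_(i < n.+2) _]big_ord_recr/=.
set s := \sum_(_ < _) _; set t := Rintegral _ _ _.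
have n1 : n.+1%:R != 0 :> R by rewrite pnatr_eq0.
have n2 : n.+2%:R != 0 :> R by rewrite pnatr_eq0.
have nE : n.+2%:R = n.+1%:R + 1 :> R by rewrite -natr1.
set a := n.+2%:R^-1 * _.
have stE : s + t = n.+2%:R * a by rewrite mulVKf.
have aE : n.+1%:R^-1 * s = a <-> s = n.+1%:R * a.
  by split=> [<-|->]; [rewrite mulVKf|rewrite mulKf].
rewrite aE; move: stE; rewrite nE mulrDl mul1r.
by split=> ?; lra.
Qed.
End integrals.

(** * The tail sigma-algebras *)

Lemma measurable_Rintegral_pprobability d d' (X : measurableType d)
    (Y : measurableType d') (R : realType) (P : X -> pprobability Y R)
    (f : Y -> R) :
  measurable_fun [set: X] P -> measurable_fun [set: Y] f ->
  measurable_fun [set: X] (fun x => \int[P x]_y f y).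
Proof.
move=> mP mf.
have ge0_m (g : Y -> \bar R) : measurable_fun [set: Y] g ->
    (forall y, 0 <= g y)%E ->
    measurable_fun [set: X] (fun x => \int[P x]_y g y)%E.
  move=> mg g0.
  apply: (@measurable_fun_integral_kernel _ _ _ _ _ (kprobability mP)) => // U.
  exact: measurable_kernel.
have mEf : measurable_fun [set: Y] (EFin \o f) by exact/measurable_EFinP.
rewrite /Rintegral; apply: measurableT_comp => //.
under eq_fun do rewrite integralE.
apply: emeasurable_funB; apply: ge0_m => //.
- exact: measurable_funepos.
- exact: measurable_funeneg.
Qed.

Section tail.
Context (R : realType) (dT dS : measure_display).
Context (T : measurableType dT) (S : measurableType dS) (P : probability T R).
Implicit Types (xi : nat -> {RV P >-> S}) (N : option nat).

(** The sample space seen with [tail N xi n] as its sigma-algebra, so that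
    arguments about measurable functions apply to tail events. *)
Definition tailType N xi n : measurableType _ :=
  g_sigma_algebraType (\bigcup_(k in [set k | (n <= k)%N /\ within N k.+1])
    preimage_set_system [set: T] (empirical xi k) measurable).

Lemma tail_measurable N xi n : tail N xi n `<=` measurable.
Proof.
apply: smallest_sub; first exact: sigma_algebra_measurable.
by move=> A [k _ [U mU <-]]; exact: measurable_empirical.
Qed.

Lemma tail_anti N xi n : tail N xi n.+1 `<=` tail N xi n.
Proof.
apply: sub_sigma_algebra2 => A [k [nk Nk] Ak]; exists k => //.
by split => //; exact: ltnW.
Qed.

Lemma measurable_empirical_tail N xi n k : (n <= k)%N -> within N k.+1 ->
  measurable_fun [set: tailType N xi n] (empirical xi k).
Proof.
move=> nk Nk _ U mU; apply: sub_sigma_algebra.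
by exists k => //; exists U.
Qed.

Lemma measurable_average_tail N xi n k (f : S -> R) : (n <= k)%N ->
  within N k.+1 -> measurable_fun [set: S] f ->
  measurable_fun [set: tailType N xi n] (fun w => \int[empirical xi k w]_x f x).
Proof.
move=> nk Nk mf; apply: measurable_Rintegral_pprobability => //.
exact: measurable_empirical_tail.
Qed.

Lemma withinS N n : within N n.+1 -> within N n.
Proof. by case: N => //= m /ltnW. Qed.

Lemma measurable_sum_tail N xi n k (f : S -> R) : (n <= k)%N ->
  within N k.+1 -> measurable_fun [set: S] f ->
  measurable_fun [set: tailType N xi n] (fun w => \sum_(i < k.+1) f (xi i w)).
Proof.
move=> nk Nk mf.
have -> : (fun w => \sum_(i < k.+1) f (xi i w)) =
    (fun w => k.+1%:R * \int[empirical xi k w]_x f x).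
  by apply/funext => w; rewrite Rintegral_empirical// mulVKf// pnatr_eq0.
apply: measurable_funM => //; exact: measurable_average_tail.
Qed.

(** The indicator of this event is a difference of two sums over the
    observations, both of which are functions of the empirical measures that
    generate the tail. *)
Lemma tail_new_observation N xi n (B : set S) : within N n.+2 -> measurable B ->
  tail N xi n (xi n.+1 @^-1` B).
Proof.
move=> Nn mB.
have mBi : measurable_fun [set: S] (\1_B : S -> R) by exact: measurable_indic.
have m0 := @measurable_sum_tail N xi n n _ (leqnn n) (withinS Nn) mBi.
have m1 := @measurable_sum_tail N xi n n.+1 _ (leqnSn n) Nn mBi.
have := measurable_funB m1 m0 => /(_ measurableT [set 1] (measurable_set1 _)).
rewrite setTI; congr (tail _ _ _ _); apply/seteqP.
have E w : \sum_(i < n.+2) (\1_B (xi i w) : R) - \sum_(i < n.+1) \1_B (xi i w)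
   = \1_B (xi n.+1 w) by rewrite big_ord_recr/= addrAC subrr add0r.
split => w /=; rewrite E indicE.
- case: (boolP (_ \in _)) => [/set_mem//|_ /eqP].
  by rewrite eq_sym oner_eq0.
- by move=> Bw; rewrite mem_set.
Qed.
End tail.

(** * Exchangeable sequences have reverse martingale empirical measures *)

Section coordinates.
Context d (S : measurableType d) (K : nat).

(** The coordinates of a tuple, as an infinite sequence so that they can play
    the part of [xi] on the space of tuples; they only matter up to index [K],
    and [inord] gives the later ones the value of the first. *)
Definition coordinate (i : nat) (x : K.+1.-tuple S) : S := tnth x (inord i).

Lemma measurable_coordinate i :
  measurable_fun [set: K.+1.-tuple S] (coordinate i).
Proof. exact: measurable_tnth. Qed.

HB.instance Definition _ i :=
  isMeasurableFun.Build _ _ _ _ (coordinate i) (measurable_coordinate i).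
End coordinates.

(** Relates the exchange of two observations in a tuple to the permutation that
    it induces on a shorter initial segment, over which an empirical measure
    averages. *)
Lemma val_tperm_inord m K (i j k : nat) :
  (m <= K)%N -> (i <= m)%N -> (j <= m)%N -> (k <= m)%N ->
  tperm (inord i : 'I_K.+1) (inord j) (inord k) =
  tperm (inord i : 'I_m.+1) (inord j) (inord k) :> nat.
Proof.
move=> mK im jm km.
rewrite !permE /= -!val_eqE /= !inordK ?ltnS ?(leq_trans _ mK)//.
by case: ifP => _; [|case: ifP => _]; rewrite !inordK ?ltnS ?(leq_trans _ mK)//.
Qed.

Section cylinders.
Context (R : realType) (dT dS : measure_display).
Context (T : measurableType dT) (S : measurableType dS) (P : probability T R).
Implicit Types (xi : nat -> {RV P >-> S}) (N : option nat).

(** The bound [K] is what makes such an event a function of finitely many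
    observations, whose law exchangeability controls. *)
Definition cylinder xi n (K : nat) (U : nat -> set (pprobability S R)) :
    set T :=
  \bigcap_(k in [set k | (n <= k <= K)%N]) (empirical xi k @^-1` U k).

Definition cylinders N xi n : set (set T) :=
  [set A | exists K U, [/\ (n <= K)%N, within N K.+1,
    (forall k, measurable (U k)) & A = cylinder xi n K U]].

Lemma setI_closed_cylinders N xi n : setI_closed (cylinders N xi n).
Proof.
move=> _ _ [K1 [U1 [nK1 NK1 mU1 ->]]] [K2 [U2 [nK2 NK2 mU2 ->]]].
exists (maxn K1 K2), (fun k => (if (k <= K1)%N then U1 k else setT) `&`
  (if (k <= K2)%N then U2 k else setT)); split.
- by rewrite leq_max nK1.
- by rewrite /maxn; case: ifP.
- by move=> k; apply: measurableI; case: ifP.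
- apply/seteqP; split => [w [w1 w2] k /= /andP[nk _]|w w12].
    by split; case: ifP => // kK; [apply: w1|apply: w2]; rewrite /= nk.
  split=> k /= /andP[nk kK].
    have [] := w12 k _; first by rewrite /= nk leq_max kK.
    by rewrite kK.
  have [] := w12 k _; first by rewrite /= nk leq_max kK orbT.
  by rewrite kK.
Qed.

Lemma cylinders_tail N xi n : within N n.+1 ->
  tail N xi n = <<s cylinders N xi n >>.
Proof.
move=> Nn; apply/seteqP; split.
  apply: smallest_sub => [|A]; first exact: smallest_sigma_algebra.
  move=> [k [nk Nk] [V mV <-]]; apply: sub_sigma_algebra.
  exists k, (fun l => if l == k then V else setT); split => //.
    by move=> l; case: ifP.
  rewrite setTI; apply/seteqP; split => [w Vw l /= _|w /(_ k)].
    by case: eqP => [->|].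
  by rewrite /= nk leqnn eqxx => /(_ isT).
apply: smallest_sub => [|A]; first exact: smallest_sigma_algebra.
move=> [K [U [nK NK mU ->]]].
apply: (@bigcap_measurableType _ (tailType N xi n)) => k /= /andP[nk kK].
rewrite -[X in measurable X]setTI.
apply: (@measurable_empirical_tail _ _ _ _ _ _ N xi n k) => //.
by case: (N) NK => //= m; exact: leq_trans.
Qed.
End cylinders.

Section martingale_of_exchangeable.
Context (R : realType) (dT dS : measure_display).
Context (T : measurableType dT) (S : measurableType dS) (P : probability T R).
Implicit Types (xi : nat -> {RV P >-> S}) (N : option nat).

Lemma eq_integral_law d' (S' : measurableType d') (X Y : {RV P >-> S'})
    (D : set S') (g : S' -> \bar R) :
  (forall A, measurable A -> distribution P X A = distribution P Y A) ->
  measurable D -> measurable_fun [set: S'] g ->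
  P.-integrable [set: T] (g \o X) -> P.-integrable [set: T] (g \o Y) ->
  (\int[P]_(w in X @^-1` D) g (X w) = \int[P]_(w in Y @^-1` D) g (Y w))%E.
Proof.
move=> XY mD mg iX iY.
have int (Z : {RV P >-> S'}) : P.-integrable [set: T] (g \o Z) ->
    (\int[P]_(w in Z @^-1` D) g (Z w) = \int[distribution P Z]_(x in D) g x)%E.
  move=> iZ; rewrite integral_pushforward//.
  apply: integrableS iZ => //.
  by rewrite -[X in measurable X]setTI; exact: measurable_funPT.
rewrite (int X)// (int Y)//.
by apply: eq_measure_integral => A mA _; exact: XY.
Qed.

(** Exchanging the observations [i] and [j] turns one integral into the other:
    it preserves the law of the first [K.+1] observations by exchangeability,
    and preserves the event because the empirical measures [n], ..., [K] all
    average over both observations. *)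
Lemma integral_cylinder N xi (f : S -> R) n i j (A : set T) :
  exchangeable N xi -> measurable_fun [set: S] f -> bounded_fun f ->
  (i <= n)%N -> (j <= n)%N -> cylinders N xi n A ->
  (\int[P]_(w in A) (f (xi i w))%:E = \int[P]_(w in A) (f (xi j w))%:E)%E.
Proof.
move=> exch mf bf i_n j_n [K [U [nK NK mU ->]]].
pose tau : 'S_K.+1 := tperm (inord i) (inord j).
pose X := joint xi (fun k : 'I_K.+1 => k).
pose Y := joint xi (fun k : 'I_K.+1 => tau k).
(* The same event on the space of tuples, the coordinates being observations. *)
pose zeta (k : nat) : {RV (distribution P X) >-> S} := @coordinate _ S K k.
pose A' : set (K.+1.-tuple S) := cylinder zeta n K U.
have mA' : measurable A'.
  apply: bigcap_measurableType => k _.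
  by rewrite -[X in measurable X]setTI; exact: measurable_empirical.
have XE w k : (n <= k <= K)%N -> empirical zeta k (X w) = empirical xi k w.
  move=> /andP[nk kK].
  apply: (@eq_empirical _ _ _ _ _ _ _ _ _ _ _ _ _ _ 1%g) => l.
  rewrite perm1 /= /coordinate tnth_mktuple inordK// ltnS.
  by rewrite (leq_trans _ kK)// -ltnS.
have YE w k : (n <= k <= K)%N -> empirical zeta k (Y w) = empirical xi k w.
  move=> /andP[nk kK].
  apply: (@eq_empirical _ _ _ _ _ _ _ _ _ _ _ _ _ _
    (tperm (inord i) (inord j))) => l.
  rewrite /= /coordinate tnth_mktuple /tau (@val_tperm_inord k).
  - by rewrite inord_val.
  - by [].
  - exact: leq_trans nk.
  - exact: leq_trans nk.
  - by rewrite -ltnS.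
have preA' (Z : {RV P >-> K.+1.-tuple S}) :
    (forall w k, (n <= k <= K)%N ->
       empirical zeta k (Z w) = empirical xi k w) ->
    cylinder xi n K U = Z @^-1` A'.
  move=> ZE; apply/seteqP; split => w wA k kK; have := wA k kK;
    by rewrite /= ZE.
have iK : (i <= K)%N by exact: leq_trans nK.
have jK : (j <= K)%N by exact: leq_trans nK.
pose g (x : K.+1.-tuple S) := (f (coordinate i x))%:E.
have gX w : (f (xi i w))%:E = g (X w).
  by rewrite /g /coordinate tnth_mktuple inordK.
have gY w : (f (xi j w))%:E = g (Y w).
  by rewrite /g /coordinate tnth_mktuple /tau tpermL inordK.
rewrite {1}(preA' X)// (preA' Y)//.
under eq_integral do rewrite gX.
under [RHS]eq_integral do rewrite gY.
apply: eq_integral_law => //.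
- by move=> B mB; apply/esym; exact: (exch K.+1).
- by apply/measurable_EFinP; apply: measurableT_comp.
- rewrite (_ : g \o X = EFin \o (f \o xi i)); last first.
    by apply/funext => w /=; rewrite gX.
  exact: integrable_bounded_RV.
- rewrite (_ : g \o Y = EFin \o (f \o xi j)); last first.
    by apply/funext => w /=; rewrite gY.
  exact: integrable_bounded_RV.
Qed.

(** The events over which the two integrals agree form a Dynkin system that
    contains the cylinders, which generate the tail and are stable under
    intersection. *)
Lemma integral_tail N xi (f : S -> R) n i j (A : set T) : within N n.+1 ->
  exchangeable N xi -> measurable_fun [set: S] f -> bounded_fun f ->
  (i <= n)%N -> (j <= n)%N -> tail N xi n A ->
  \int[P]_(w in A) f (xi i w) = \int[P]_(w in A) f (xi j w).
Proof.
move=> Nn exch mf bf i_n j_n tA; congr fine; move: tA; rewrite cylinders_tail//.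
have int k : P.-integrable [set: T] (fun w => (f (xi k w))%:E).
  exact: integrable_bounded_RV.
have tail_m B : <<s cylinders N xi n >> B -> dT.-measurable B.
  by rewrite -cylinders_tail//; exact: tail_measurable.
have intC (B : set T) k : measurable B -> (\int[P]_(w in ~` B) (f (xi k w))%:E =
    \int[P]_w (f (xi k w))%:E - \int[P]_(w in B) (f (xi k w))%:E)%E.
  move=> mB.
  have disjB : [disjoint B & ~` B] by apply/disj_setPS; rewrite setICr.
  have mk : measurable_fun (B `|` ~` B) (fun w => (f (xi k w))%:E).
    by rewrite setUv; have /integrableP[] := int k.
  have := integral_setU P mB (measurableC mB) mk disjB; rewrite setUv => ->.
  rewrite addeAC subee ?add0e//; apply: integrable_fin_num => //.
  exact: integrableS (int k).
have intT : (\int[P]_w (f (xi i w))%:E = \int[P]_w (f (xi j w))%:E)%E.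
  apply: (integral_cylinder exch mf bf i_n j_n).
  exists n, (fun=> setT); split => //.
  by apply/seteqP; split.
move: A; apply: (@dynkin_induction _ (g_sigma_algebraType (cylinders N xi n))).
- by [].
- exact: (@setI_closed_cylinders _ _ _ _ _ _ N xi n).
- exact: intT.
- by move=> A GA; apply: (integral_cylinder exch mf bf i_n j_n GA).
- move=> A /tail_m mA IA.
  by rewrite !intC// intT IA.
- move=> F mF tF IF; rewrite !integral_bigcup//.
  + by apply: eq_eseriesr => k _; exact: IF.
  + by move=> k; exact: tail_m (mF k).
  + apply: integrableS (int j) => //.
    by apply: bigcupT_measurable => k; exact: tail_m (mF k).
  + by move=> k; exact: tail_m (mF k).
  + apply: integrableS (int i) => //.
    by apply: bigcupT_measurable => k; exact: tail_m (mF k).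
Qed.

Lemma exchangeable_reverse_martingale N xi :
  exchangeable N xi -> reverse_martingale N xi.
Proof.
move=> exch f mf bf n Nn.
exists (fun w => \int[empirical xi n.+1 w]_x f x); last exact: aeW.
split.
- exact: integrable_average.
- exact: integrable_average.
- move=> B mB; rewrite -[X in tail _ _ _ X]setTI.
  by apply: (@measurable_average_tail _ _ _ _ _ _ N xi n.+1 n.+1).
- move=> A tA; apply/esym; apply/average_step_new_observation => //;
    first exact: tail_measurable tA.
  rewrite Rintegral_average//; last exact: tail_measurable tA.
  rewrite (eq_bigr (fun=> \int[P]_(w in A) f (xi n.+1 w))).
    by rewrite sumr_const card_ord -[X in _ * X]mulr_natl mulKf// pnatr_eq0.
  move=> i _; apply: (integral_tail Nn exch mf bf _ _ tA) => //.
  by rewrite -ltnS.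
Qed.

End martingale_of_exchangeable.

(** * Laws on tuples are determined by rectangles *)

Section rectangles.
Context d (S : measurableType d) (n : nat).

Definition rectangle (B : 'I_n -> set S) : set (n.-tuple S) :=
  [set x | forall i, B i (tnth x i)].

Definition rectangles : set (set (n.-tuple S)) :=
  [set rectangle B | B in [set B | forall i, measurable (B i)]].

Lemma measurable_rectangle B : (forall i, measurable (B i)) ->
  measurable (rectangle B).
Proof.
move=> mB; have -> : rectangle B =
    \bigcap_(i in [set: 'I_n]) ((@tnth _ S ^~ i) @^-1` B i).
  by apply/seteqP; split=> [x xB i _|x xB i]; [exact: xB|exact: (xB i)].
apply: fin_bigcap_measurable => [|i _]; first exact: finite_finset.
by rewrite -[X in measurable X]setTI; exact: measurable_tnth.
Qed.

Lemma setI_closed_rectangles : setI_closed rectangles.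
Proof.
move=> _ _ [B mB <-] [B' mB' <-]; exists (fun i => B i `&` B' i) => [i|].
  exact: measurableI.
by apply/seteqP; split=> [x xB|x [xB xB'] i]; [split => i; case: (xB i)|split].
Qed.

Lemma measurable_tuple_rectangles :
  @measurable _ (n.-tuple S) = <<s rectangles >>.
Proof.
apply/seteqP; split; last first.
  apply: smallest_sub; first exact: sigma_algebra_measurable.
  by move=> _ [B mB <-]; exact: measurable_rectangle.
apply: smallest_sub => [|A]; first exact: smallest_sigma_algebra.
rewrite -bigcup_seq => -[/= i _ [Y mY <-]]; apply: sub_sigma_algebra.
exists (fun j => if j == i then Y else setT) => [j|].
  by case: ifP.
apply/seteqP; split=> [x /(_ i)|x [_ xY] j]; first by rewrite eqxx.
by case: eqP => [->|].
Qed.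

Lemma eq_probability_tuple (R : realType) (m1 m2 : probability (n.-tuple S) R) :
  (forall B, (forall i, measurable (B i)) ->
    m1 (rectangle B) = m2 (rectangle B)) ->
  forall A, measurable A -> m1 A = m2 A.
Proof.
move=> m12 A mA; apply: (measure_unique rectangles (fun=> setT)) => //.
- exact: measurable_tuple_rectangles.
- exact: setI_closed_rectangles.
- by move=> _; exists (fun=> setT) => //; apply/seteqP; split.
- by rewrite bigcup_const.
- by move=> _ [B mB <-]; exact: m12.
- by move=> _; rewrite (le_lt_trans (probability_le1 m1 _))// ltry.
Qed.
End rectangles.

(** * Reverse martingale empirical measures come from exchangeable sequences *)

Section martingale.
Context (R : realType) (dT dS : measure_display).
Context (T : measurableType dT) (S : measurableType dS) (P : probability T R).
Implicit Types (xi : nat -> {RV P >-> S}) (N : option nat).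

Lemma bounded_indic (B : set S) : bounded_fun (\1_B : S -> R).
Proof.
exists 1; split => // M M1 x _ /=; rewrite indicE.
by apply: le_trans (ltW M1); case: (_ \in _); rewrite ?normr1 ?normr0.
Qed.

Lemma Rintegral_indic_RV (X : {RV P >-> S}) (A : set T) (B : set S) :
  measurable A -> measurable B ->
  \int[P]_(w in A) \1_B (X w) = fine (P (A `&` X @^-1` B)).
Proof.
move=> mA mB; rewrite /Rintegral setIC; congr fine.
rewrite -[RHS]integral_indic//.
by rewrite -[X in measurable X]setTI; exact: measurable_funPT.
Qed.

(** The form in which the martingale property is used: given the tail at
    [n.+1], the observation [xi n.+1] is a uniform draw from the empirical
    measure that it completes. *)
Lemma martingale_new_observation N xi n (f : S -> R) (A : set T) :
  reverse_martingale N xi -> within N n.+2 ->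
  measurable_fun [set: S] f -> bounded_fun f -> tail N xi n.+1 A ->
  \int[P]_(w in A) f (xi n.+1 w) =
  \int[P]_(w in A) (\int[empirical xi n.+1 w]_x f x).
Proof.
move=> mart Nn mf bf tA.
have mA := tail_measurable tA.
have [Z [_ iZ _ ZE] Zae] := mart f mf bf n Nn.
apply/(average_step_new_observation mf bf xi n mA); rewrite -ZE//.
congr fine; apply: ae_eq_integral => //.
- by apply: measurable_int; apply: integrableS iZ.
- apply: measurable_int.
  by apply: integrableS (integrable_average mf bf xi n.+1).
- by apply: filterS Zae => w /= ->.
Qed.

Section discrete.
Context (K : finType) (c : S -> K).
Context (mc : forall b, measurable (c @^-1` [set b])).

Definition word xi n w : seq K := [seq c (xi i w) | i <- iota 0 n].

Lemma word_rcons xi n w : word xi n.+1 w = rcons (word xi n w) (c (xi n w)).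
Proof. by rewrite /word -addn1 iotaD map_cat cats1. Qed.

Lemma count_word xi n w b : (count_mem b (word xi n w))%:R =
  \sum_(i < n) \1_(c @^-1` [set b]) (xi i w) :> R.
Proof.
elim: n => [|n IHn]; first by rewrite big_ord0.
rewrite word_rcons -cats1 count_cat natrD IHn big_ord_recr/= addn0 indicE.
congr (_ + _%:R); congr nat_of_bool.
by apply/eqP/idP => [<-|/set_mem//]; rewrite inE.
Qed.

Lemma perm_eq_counts (s t : seq K) :
  perm_eq s t <-> forall b, count_mem b s = count_mem b t.
Proof.
split=> [/seq.permP st b|st]; first exact: st.
by apply/allP => b _ /=; apply/eqP.
Qed.

(** Being a rearrangement of [a] is a condition on the number of observations
    of each colour, hence on the empirical measure. *)
Lemma tail_perm_eq_word N xi n a : within N n.+1 ->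
  tail N xi n [set w | perm_eq (word xi n.+1 w) a].
Proof.
move=> Nn.
have -> : [set w | perm_eq (word xi n.+1 w) a] =
    \bigcap_(b in [set: K]) ((fun w => \sum_(i < n.+1)
      (\1_(c @^-1` [set b]) (xi i w) : R)) @^-1` [set (count_mem b a)%:R]).
  apply/seteqP; split => w /=.
    by move=> /perm_eq_counts wa b _ /=; rewrite -count_word wa.
  move=> wa; apply/perm_eq_counts => b; apply/eqP.
  by rewrite -(eqr_nat R) count_word; apply/eqP; exact: wa.
apply: (@fin_bigcap_measurable _ (tailType N xi n)) => [|b _].
  exact: finite_finset.
rewrite -[X in measurable X]setTI.
by apply: (@measurable_sum_tail _ _ _ _ _ _ N xi n n).
Qed.

Lemma prod_count_fact_rcons (u : seq K) b :
  (\prod_d (count_mem d (rcons u b))`! =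
   count_mem b (rcons u b) * \prod_d (count_mem d u)`!)%N.
Proof.
rewrite (bigD1 b)//= [in RHS](bigD1 b)//= mulnA -cats1 count_cat/= eqxx.
rewrite addn0 addn1 factS; congr (_ * _)%N; apply: eq_bigr => d db.
by rewrite count_cat/= eq_sym (negPf db) !addn0.
Qed.

Lemma measurable_word_eq xi n a : measurable [set w | word xi n w = a].
Proof.
elim: n a => [|n IHn] a.
  rewrite /word/=; case: a => [|b a].
    by rewrite (_ : [set _ | _] = setT)//; apply/seteqP; split.
  by rewrite (_ : [set _ | _] = set0)//; apply/seteqP; split.
case/lastP: a => [|u b].
  by rewrite (_ : [set _ | _] = set0)//; apply/seteqP; split.
rewrite (_ : [set _ | _] =
    [set w | word xi n w = u] `&` xi n @^-1` (c @^-1` [set b])).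
  apply: measurableI => //.
  by rewrite -[X in measurable X]setTI; exact: measurable_funPT.
apply/seteqP; split => w /=; rewrite word_rcons.
  by move/rcons_inj => [-> ->].
by move=> [-> ->].
Qed.

(** Given the tail at [n], the colours of the first [n.+1] observations come in
    uniformly random order: a word has (n+1)! / prod_b (number of b)!
    rearrangements, and each of them has the same probability. Stating this
    with an arbitrary tail event [A] makes the induction work: the colour of
    the last observation is absorbed into [A]. *)
Lemma word_law N xi n (A : set T) (a : seq K) :
  reverse_martingale N xi -> within N n.+1 -> tail N xi n A -> size a = n.+1 ->
  (n.+1)`!%:R * fine (P (A `&` [set w | word xi n.+1 w = a])) =
  (\prod_b (count_mem b a)`!)%:R *
    fine (P (A `&` [set w | perm_eq (word xi n.+1 w) a])).
Proof.
move=> mart.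
elim: n A a => [|n IHn] A a Nn tA sa.
  case: a sa => [|b []]// _.
  rewrite (_ : 1`! = 1)%N// big1 ?mul1r => [|d _]; last first.
    by rewrite /= addn0; case: eqP.
  congr (fine (P (_ `&` _))); apply/seteqP; split => w /=.
    by move=> ->.
  by rewrite perm_sym => /perm_small_eq ->.
case/lastP: a sa => // u b; rewrite size_rcons => -[su].
(* The martingale property is applied on C, which is a tail event at n.+1, and
   the induction hypothesis on A & xi n.+1 @^-1` B, which is one at n. *)
pose B := c @^-1` [set b].
pose C := A `&` [set w | perm_eq (word xi n.+2 w) (rcons u b)].
have tC : tail N xi n.+1 C.
  apply: (@measurableI _ (tailType N xi n.+1)) => //.
  exact: tail_perm_eq_word.
have mC : measurable C by exact: tail_measurable tC.
have tA' : tail N xi n (A `&` xi n.+1 @^-1` B).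
  apply: (@measurableI _ (tailType N xi n)); first exact: tail_anti.
  by apply: tail_new_observation => //; exact: mc.
have := IHn _ u (withinS Nn) tA' su.
have -> : A `&` xi n.+1 @^-1` B `&` [set w | word xi n.+1 w = u] =
   A `&` [set w | word xi n.+2 w = rcons u b].
  apply/seteqP; split => w /=; rewrite (word_rcons xi n.+1).
    by move=> [[Aw ->] ->].
  by move=> [Aw /rcons_inj[-> ?]].
have -> : A `&` xi n.+1 @^-1` B `&` [set w | perm_eq (word xi n.+1 w) u] =
   C `&` xi n.+1 @^-1` B.
  apply/seteqP; split => w /=; rewrite /C/= (word_rcons xi n.+1) -!cats1.
    by move=> [[Aw wb] wu]; rewrite wb perm_cat2r.
  by move=> [[Aw +] wb]; rewrite wb perm_cat2r.
have := martingale_new_observation mart Nn (measurable_indic (mc b))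
  (bounded_indic B) tC.
rewrite Rintegral_indic_RV//.
(* On C the proportion of observations of colour b is known. *)
have -> :
    \int[P]_(w in C) (\int[empirical xi n.+1 w]_x \1_(c @^-1` [set b]) x) =
    \int[P]_(w in C) (n.+2%:R^-1 * (count_mem b (rcons u b))%:R).
  apply: eq_Rintegral => w /set_mem[_ /= /perm_eq_counts <-].
  by rewrite Rintegral_empirical// ?count_word//; exact: measurable_indic.
rewrite Rintegral_cst// prod_count_fact_rcons -/B => -> IH.
rewrite (factS n.+1) natrM -mulrA {}IH natrM -/C.
have : n.+2%:R != 0 :> R by rewrite pnatr_eq0.
by move: n.+2%:R => m m0; field.
Qed.
End discrete.
End martingale.

Section exchangeable_of_martingale.
Context (R : realType) (dT dS : measure_display).
Context (T : measurableType dT) (S : measurableType dS) (P : probability T R).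
Implicit Types (xi : nat -> {RV P >-> S}) (N : option nat).

Lemma word_exchangeable N xi (K : finType) (c : S -> K) n (a a' : seq K) :
  (forall b, measurable (c @^-1` [set b])) ->
  reverse_martingale N xi -> within N n.+1 -> size a = n.+1 -> perm_eq a a' ->
  P [set w | word c xi n.+1 w = a] = P [set w | word c xi n.+1 w = a'].
Proof.
move=> mc mart Nn sa aa'.
have tT : tail N xi n setT by exact: (@measurableT _ (tailType N xi n)).
have law := word_law mc mart Nn tT.
have sa' : size a' = n.+1 by rewrite -(perm_size aa').
have := law _ sa; under eq_bigr do rewrite (seq.permP aa').
have -> : [set w | perm_eq (word c xi n.+1 w) a] =
    [set w | perm_eq (word c xi n.+1 w) a'].
  by apply/seteqP; split => w /=; rewrite (permPr aa').
rewrite -(law _ sa') !setTI => /mulfI H.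
rewrite -[LHS]fineK ?fin_num_measure//; last exact: measurable_word_eq.
rewrite -[RHS]fineK ?fin_num_measure//; last exact: measurable_word_eq.
by rewrite H// pnatr_eq0 -lt0n fact_gt0.
Qed.

Lemma reverse_martingale_exchangeable N xi :
  reverse_martingale N xi -> exchangeable N xi.
Proof.
move=> mart [//|n] _ Nn pi.
apply: eq_probability_tuple => B mB.
(* The coarsest finite colouring that decides membership in every B i. *)
pose c x : {ffun 'I_n.+1 -> bool} := [ffun i => x \in B i].
have mc b : measurable (c @^-1` [set b]).
  have -> : c @^-1` [set b] =
      \bigcap_(i in [set: 'I_n.+1]) (if b i then B i else ~` B i).
    apply/seteqP; split => [x /= <- i _|x xb].
      by rewrite ffunE; case: ifP => [/set_mem|/negbT]//; rewrite notin_setE.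
    apply/ffunP => i; rewrite ffunE; have := xb i I.
    by case: (b i) => xB; [exact: mem_set|exact: memNset].
  apply: fin_bigcap_measurable => [|i _]; first exact: finite_finset.
  by case: ifP => // _; exact: measurableC.
pose D (s : 'S_n.+1) := [set a : n.+1.-tuple {ffun 'I_n.+1 -> bool} |
  forall i, tnth a (s i) i].
pose F (a : n.+1.-tuple {ffun 'I_n.+1 -> bool}) :=
  P [set w | word c xi n.+1 w = a].
have wordE w : word c xi n.+1 w = [tuple c (xi i w) | i < n.+1].
  by rewrite /word -val_enum_ord -map_comp.
have rectE (s : 'S_n.+1) :
    P (joint xi (fun i => s i) @^-1` rectangle B) = (\sum_(a \in D s) F a)%R.
  rewrite -measure_fin_bigcup.
  - congr (P _); apply/seteqP; split => w /=.
      move=> wB; exists [tuple c (xi i w) | i < n.+1]; last by rewrite /= wordE.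
      move=> i; rewrite tnth_mktuple ffunE; apply/mem_set.
      by have := wB i; rewrite tnth_mktuple.
    move=> [a Da /=]; rewrite wordE => /val_inj aE i.
    have := Da i; rewrite -aE !tnth_mktuple ffunE.
    by move=> /set_mem.
  - exact: finite_finset.
  - move=> a a' _ _ [w [/= wa wa']]; apply: val_inj.
    by rewrite /= -wa wa'.
  - by move=> a _; exact: measurable_word_eq.
rewrite [LHS]rectE.
transitivity (P (joint xi (fun i => (1%g : 'S_n.+1) i) @^-1` rectangle B));
  last first.
  congr (P _); apply/seteqP.
  by split => w wB i; have := wB i; rewrite !tnth_mktuple perm1.
rewrite rectE.
(* Rearranging by pi is a bijection from D pi onto D 1, and it preserves the
   probability of each word. *)
pose h (a : n.+1.-tuple {ffun 'I_n.+1 -> bool}) :=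
  [tuple tnth a (pi i) | i < n.+1].
rewrite [RHS](reindex_fsbig h (D pi)).
  apply: eq_fsbigr => a _; rewrite /F.
  apply: (word_exchangeable mc mart Nn); first by rewrite size_tuple.
  by rewrite perm_sym; apply/tuple_permP; exists pi.
split.
- by move=> a Da i; rewrite perm1 tnth_mktuple; exact: Da.
- move=> a a' _ _ /(congr1 (fun t => tnth t)) haa'; apply: eq_from_tnth => i.
  have := congr1 (fun f => f (pi^-1 i)%g) haa'.
  by rewrite /h !tnth_mktuple permKV.
- move=> a Da; exists [tuple tnth a ((pi^-1)%g i) | i < n.+1].
    by move=> i; rewrite tnth_mktuple permK; have := Da i; rewrite perm1.
  by apply: eq_from_tnth => i; rewrite !tnth_mktuple permK.
Qed.
End exchangeable_of_martingale.

Theorem theorem1p3 (R : realType) (dT dS : measure_display)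
    (T : measurableType dT) (S : measurableType dS) (P : probability T R)
    (hS : standard_borel R S) (N : option nat) (xi : nat -> {RV P >-> S}) :
  exchangeable N xi <-> reverse_martingale N xi.
Proof.
split; first exact: exchangeable_reverse_martingale.
exact: reverse_martingale_exchangeable.
Qed.
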